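(* Let $H$ be a complex Hilbert space. If $A\in B(H)$ is hyponormal and $r=\min\{\lambda,1-\lambda\}$, where $0\leq\lambda\leq 1$, then $$w(A)\leq \frac{1}{\displaystyle\inf_{\|x\|=1}\zeta(x)}\cdot\frac{\big\|\,|A|+|A^{*}|\,\big\|}{2},$$ where $$\zeta(x)=K\!\left(\frac{\langle |A|x,x\rangle}{\langle |A^{*}|x,x\rangle},2\right)^{r},$$ and this is a refinement of the inequality $\frac12\|A\|\leq w(A)\leq\|A\|$.
   Context: $B(H)$ denotes the $C^*$-algebra of all bounded linear operators on the complex Hilbert space $H$ with inner product $\langle\cdot,\cdot\rangle$, and $\|\cdot\|$ is the usual operator norm. The numerical radius of $A\in B(H)$ is $w(A)=\sup\{|\langle Ax,x\rangle| : x\in H,\ \|x\|=1\}$. For $T\in B(H)$, $|T|=(T^*T)^{1/2}$. An operator $A\in B(H)$ is hyponormal if $A^*A-AA^*\geq 0$. The Kantorovich constant is $K(h,2)=\frac{(h+1)^2}{4h}$ for $h>0$. The infimum is over unit vectors $x\in H$. It is well known that $\frac12\|A\|\leq w(A)\leq\|A\|$ for every $A\in B(H)$. *)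

(* Defs.v *)
From mathcomp Require Import all_boot all_order all_algebra.
From mathcomp Require Import sesquilinear complex.
From mathcomp Require Import all_classical all_reals all_analysis.

Set Implicit Arguments.
Unset Strict Implicit.
Unset Printing Implicit Defensive.

Import Order.TTheory GRing.Theory Num.Theory.
Import numFieldNormedType.Exports.

Local Open Scope classical_set_scope.
Local Open Scope ring_scope.

(* K(h, 2) *)
Definition kantorovich2 (R : realType) (h : R) : R := (h + 1) ^+ 2 / (4 * h).

(* The norm of a normed space over R[i] takes (real) values in R[i]; rnorm is
   the same number in R. It serves both for vectors and for scalars. *)
Definition rnorm (R : realType) (V : normedZmodType R[i]) (x : V) : R :=
  complex.Re `|x|.

Section Operators.
Variables (R : realType) (H : normedModType R[i]).

Definition bounded_op (T : H -> H) : Prop :=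
  exists M : R, forall x : H, rnorm (T x) <= M * rnorm x.

Definition opnorm (T : H -> H) : R :=
  sup [set rnorm (T x) | x in [set x : H | rnorm x <= 1]].

Variable dot : {dot H for (@Num.conj R[i])}.

(* On R[i], 0 <= z means that z is real and nonnegative. *)
Definition positive_op (T : H -> H) : Prop := forall x : H, 0 <= dot (T x) x.

(* <T x, x> as an element of R, for T positive. *)
Definition qform (T : H -> H) (x : H) : R := complex.Re (dot (T x) x).

(* T^*: on a Hilbert space a bounded T has exactly one such S. *)
Definition adjoint (T : {linear H -> H}) : {linear H -> H} :=
  get [set S : {linear H -> H} |
        bounded_op S /\ forall x y : H, dot (T x) y = dot x (S y)].

(* |T| = (T^* T)^(1/2): on a Hilbert space, for T bounded, T^* T has exactly one
   bounded positive square root. *)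
Definition abs_op (T : {linear H -> H}) : {linear H -> H} :=
  get [set P : {linear H -> H} |
        [/\ bounded_op P, positive_op P &
            forall x : H, P (P x) = adjoint T (T x)]].

Definition hyponormal (T : {linear H -> H}) : Prop :=
  positive_op (fun x => adjoint T (T x) - T (adjoint T x)).

Definition numradius (T : H -> H) : R :=
  sup [set rnorm (dot (T x) x) | x in [set x : H | rnorm x = 1]].

Definition zeta (A : {linear H -> H}) (r : R) (x : H) : R :=
  kantorovich2 (qform (abs_op A) x / qform (abs_op (adjoint A)) x) `^ r.

(* The quotient in zeta is defined only for <|A^*| x, x> != 0, so the infimum
   runs over the unit vectors with this property. For A bounded there is no such
   vector only if A = 0; then inf set0 = 0. *)
Definition inf_zeta (A : {linear H -> H}) (r : R) : R :=
  inf [set zeta A r x | x in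
        [set x : H | rnorm x = 1 /\ qform (abs_op (adjoint A)) x != 0]].

End Operators.

(* Main.v *)
Require Import Defs.
From HB Require Import structures.
From mathcomp Require Import all_boot all_order all_algebra.
From mathcomp Require Import sesquilinear complex.
From mathcomp Require Import all_classical all_reals all_analysis.
From mathcomp Require Import ring lra.

Set Implicit Arguments.
Unset Strict Implicit.
Unset Printing Implicit Defensive.

Import Order.TTheory GRing.Theory Num.Theory.
Import numFieldNormedType.Exports.

Local Open Scope classical_set_scope.
Local Open Scope ring_scope.
Local Open Scope complex_scope.

(** Write P = |A| and Q = |A^*|, and, for a unit vector x, a = <P x, x> and
    b = <Q x, x>. The mixed Schwarz inequality (mixed_schwarz_diag) gives
    |<A x, x>|^2 <= a b. The geometric mean of a and b is their arithmetic mean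
    divided by K(a / b, 2)^(1/2), and K >= 1 while r <= 1/2, so
    |<A x, x>| zeta(x) <= (a + b) / 2 <= ||P + Q|| / 2 (amgm_kantorovich2).
    Replacing zeta(x) by its infimum gives the upper bound for w(A).
    Hyponormality says ||A^* x|| <= ||A x||; it ensures that a > 0 as soon as b > 0,
    hence that zeta >= 1 wherever the infimum looks at it. The bound is then at
    most ||P + Q|| / 2 <= ||A||, because ||P x|| = ||A x|| and ||Q x|| = ||A^* x||.
    The inequality ||A|| / 2 <= w(A) is polarization (opnorm_le_numradius).

    This presupposes that A^* and the absolute values exist. Both adjoints and
    the shifted inverses (P + t^2)^(-1) come from minimizing a quadratic energy
    (lax_milgram). The square root of A^* A is, up to scaling, 1 - Y where Y is
    the limit of Y_(n+1) = (Z + Y_n^2) / 2 and Z = 1 - A^* A / M^2 is a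
    contraction (sqrt_contraction).

    The mixed Schwarz inequality rests on A P = Q A (sqrt_intertwine). For an
    arbitrary choice of the positive roots P and Q, the defect X = A P - Q A
    satisfies Q X + X P = 0, and testing this equation at vectors where X almost
    attains its norm shows X = 0 (sylvester_eq0). *)

(** * The underlying real inner product *)

Section RealStructure.
Variables (R : realType) (H : normedModType R[i]).
Implicit Types (x y z : H) (t : R).

Lemma rnormE (V : normedZmodType R[i]) (x : V) : `|x| = (rnorm x)%:C.
Proof. by rewrite /rnorm RRe_real // normr_real. Qed.

Lemma rnorm_ge0 (V : normedZmodType R[i]) (x : V) : 0 <= rnorm x.
Proof. by rewrite -ler0c -rnormE. Qed.

Lemma rnorm_eq0 (V : normedZmodType R[i]) (x : V) : rnorm x = 0 -> x = 0.
Proof. by move=> h; apply/eqP; rewrite -normr_eq0 rnormE h. Qed.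

Lemma rnorm0 (V : normedZmodType R[i]) : rnorm (0 : V) = 0.
Proof. by rewrite /rnorm normr0. Qed.

Lemma rnormN (V : normedZmodType R[i]) (x : V) : rnorm (- x) = rnorm x.
Proof. by rewrite /rnorm normrN. Qed.

Lemma rnormB (V : normedZmodType R[i]) (x y : V) : rnorm (x - y) = rnorm (y - x).
Proof. by rewrite /rnorm distrC. Qed.

Lemma rnormD (V : normedZmodType R[i]) (x y : V) :
  rnorm (x + y) <= rnorm x + rnorm y.
Proof. by rewrite -lecR rmorphD /= -!rnormE ler_normD. Qed.

Lemma rnorm_triangle (V : normedZmodType R[i]) (y x z : V) :
  rnorm (x - z) <= rnorm (x - y) + rnorm (y - z).
Proof. by have := rnormD (x - y) (y - z); rewrite addrA subrK. Qed.

Lemma rnormZ (a : R[i]) x : rnorm (a *: x) = rnorm a * rnorm x.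
Proof. by apply: (@complexI R); rewrite rmorphM /= -!rnormE normrZ. Qed.

Lemma rnormM (a b : R[i]) : rnorm (a * b) = rnorm a * rnorm b.
Proof. by apply: (@complexI R); rewrite rmorphM /= -!rnormE normrM. Qed.

Lemma rnorm_real t : rnorm t%:C = `|t|.
Proof. by apply: (@complexI R); rewrite -rnormE normc_def /= expr0n addr0 sqrtr_sqr. Qed.

Lemma rnormZr t x : rnorm (t%:C *: x) = `|t| * rnorm x.
Proof. by rewrite rnormZ rnorm_real. Qed.

Lemma scale_i_i x : 'i *: ('i *: x) = - x.
Proof. by rewrite scalerA -expr2 sqr_i scaleN1r. Qed.

Variable dot : {dot H for (@Num.conj R[i])}.

(** The real inner product underlying dot. Since its value at (x, i y) is the
    imaginary part of dot x y, no information is lost, and all estimates become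
    inequalities in the linearly ordered field R. *)
Definition re_dot x y : R := complex.Re (dot x y).
Local Notation ip := re_dot.

Lemma dotC x y : dot y x = (dot x y)^*.
Proof. by rewrite (hermC dot) expr0 mul1r. Qed.

Lemma ipC x y : ip x y = ip y x.
Proof. by rewrite /re_dot (dotC y x); case: (dot y x). Qed.

Lemma ipDl x y z : ip (x + y) z = ip x z + ip y z.
Proof. by rewrite /re_dot (linearDl dot) raddfD. Qed.

Lemma ipNl x z : ip (- x) z = - ip x z.
Proof. by rewrite /re_dot (linearNl dot) raddfN. Qed.

Lemma ipBl x y z : ip (x - y) z = ip x z - ip y z.
Proof. by rewrite ipDl ipNl. Qed.

Lemma ipZl t x y : ip (t%:C *: x) y = t * ip x y.
Proof.
rewrite /re_dot (linearZl_LR dot) /=; case: (dot x y) => a b /=.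
by rewrite mul0r subr0.
Qed.

Lemma ipDr x y z : ip z (x + y) = ip z x + ip z y.
Proof. by rewrite !(ipC z) ipDl. Qed.

Lemma ipNr x z : ip z (- x) = - ip z x.
Proof. by rewrite !(ipC z) ipNl. Qed.

Lemma ipBr x y z : ip z (x - y) = ip z x - ip z y.
Proof. by rewrite !(ipC z) ipBl. Qed.

Lemma ipZr t x y : ip x (t%:C *: y) = t * ip x y.
Proof. by rewrite !(ipC x) ipZl. Qed.

Lemma ip0l x : ip 0 x = 0.
Proof. by rewrite /re_dot (linear0l dot). Qed.

Lemma ip_il x y : ip ('i *: x) y = - complex.Im (dot x y).
Proof.
by rewrite /re_dot (linearZl_LR dot) /=; case: (dot x y) => a b /=; rewrite mul0r mul1r sub0r.
Qed.

Lemma ip_ir x y : ip x ('i *: y) = complex.Im (dot x y).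
Proof. by rewrite ipC ip_il (dotC x y); case: (dot x y) => a b /=; rewrite opprK. Qed.

Definition ipE := (ipDl, ipDr, ipNl, ipNr, ipZl, ipZr).

Lemma ip_ii x y : ip ('i *: x) ('i *: y) = ip x y.
Proof. by rewrite ip_il -ip_ir scale_i_i ipNr opprK. Qed.

(** Multiplying y by the phase of dot x y turns a bound on real parts into a
    bound on moduli; using dot x y itself as the factor avoids dividing. *)
Lemma ip_scale_dot x y : ip x (dot x y *: y) = rnorm (dot x y) ^+ 2.
Proof.
rewrite /re_dot (linearZr_LR dot) /= mulrC.
have -> : dot x y * (dot x y)^* = (rnorm (dot x y) ^+ 2)%:C by rewrite -sqr_normc rnormE -rmorphXn.
by [].
Qed.

Hypothesis norm_dot : forall x, `|x| ^+ 2 = dot x x.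

Lemma ipxx x : ip x x = rnorm x ^+ 2.
Proof. by rewrite /re_dot -norm_dot rnormE -rmorphXn. Qed.

Lemma ip_ge0 x : 0 <= ip x x.
Proof. by rewrite ipxx sqr_ge0. Qed.

Lemma ip_nondeg x y : (forall z, ip z x = ip z y) -> x = y.
Proof.
move=> h; apply/eqP; rewrite -subr_eq0; apply/eqP/rnorm_eq0.
by apply/eqP; rewrite -sqrf_eq0 -ipxx ipBr h subrr.
Qed.

End RealStructure.

Lemma discriminant_le (R : realFieldType) (a b c : R) :
  0 <= a -> 0 <= c -> (forall t, 0 <= a + 2 * t * b + t ^+ 2 * c) ->
  b ^+ 2 <= a * c.
Proof.
move=> a0 c0 h; have [c_eq|c_neq] := eqVneq c 0.
  have [->|b_neq] := eqVneq b 0; first by rewrite expr0n mulr_ge0.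
  have := h (- (a + 1) / (2 * b)); rewrite c_eq mulr0 addr0.
  have -> : 2 * (- (a + 1) / (2 * b)) * b = - (a + 1) by field.
  lra.
have cp : 0 < c by rewrite lt_neqAle eq_sym c_neq.
have := h (- b / c).
have -> : a + 2 * (- b / c) * b + (- b / c) ^+ 2 * c = (a * c - b ^+ 2) / c by field.
by rewrite pmulr_lge0 ?invr_gt0// subr_ge0.
Qed.

(** * Limits of sequences and positive operators *)

Section Limits.
Variables (R : realType) (H : normedModType R[i]).

(** Norm convergence with real tolerances: the norm of H itself takes its values
    in R[i], where the order is only partial. *)
Definition tends (u : nat -> H) (l : H) : Prop :=
  forall e : R, 0 < e -> exists N, forall n, (N <= n)%N -> rnorm (u n - l) <= e.

Lemma tends_unique u l l' : tends u l -> tends u l' -> l = l'.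
Proof.
move=> ul ul'; apply/eqP; rewrite -subr_eq0; apply/eqP/rnorm_eq0.
apply/eqP; rewrite eq_le rnorm_ge0 andbT; apply/ler_addgt0Pl => e e0.
have e2 : 0 < e / 2 by lra.
have [N hN] := ul _ e2; have [N' hN'] := ul' _ e2.
have h := hN _ (leq_maxl N N'); have h' := hN' _ (leq_maxr N N').
have := rnorm_triangle (u (maxn N N')) l l'; rewrite (rnormB l (u _)); lra.
Qed.

Lemma tends_bound u l (x : H) M :
  tends u l -> (forall n, rnorm (u n - x) <= M) -> rnorm (l - x) <= M.
Proof.
move=> ul ux; apply/ler_addgt0Pl => e e0; have [N hN] := ul _ e0.
have := rnorm_triangle (u N) l x; rewrite (rnormB l (u _)).
by move=> /le_trans; apply; rewrite lerD ?hN.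
Qed.

Lemma tendsD u v l m : tends u l -> tends v m -> tends (fun n => u n + v n) (l + m).
Proof.
move=> ul vm e e0; have e2 : 0 < e / 2 by lra.
have [N hN] := ul _ e2; have [N' hN'] := vm _ e2.
exists (maxn N N') => n; rewrite geq_max => /andP[/hN h /hN' h'].
have /= := rnormD (u n - l) (v n - m); rewrite addrACA -opprD; lra.
Qed.

Lemma tendsZ a u l : tends u l -> tends (fun n => a *: u n) (a *: l).
Proof.
move=> ul e e0.
have a0 := rnorm_ge0 a; have a1 : 0 < rnorm a + 1 by lra.
have [N hN] := ul (e / (rnorm a + 1)) (divr_gt0 e0 a1); exists N => n /hN h.
rewrite -scalerBr rnormZ.
apply: (@le_trans _ _ ((rnorm a + 1) * (e / (rnorm a + 1)))); last by rewrite mulrC divfK ?gt_eqF.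
by apply: ler_pM => //; [exact: rnorm_ge0|lra].
Qed.

Lemma tends_cst x : tends (fun=> x) x.
Proof. by move=> e e0; exists 0%N => n _; rewrite subrr rnorm0 ltW. Qed.

Lemma bounded_op_pos (T : H -> H) :
  bounded_op T -> exists2 M : R, 0 < M & forall x, rnorm (T x) <= M * rnorm x.
Proof.
case=> M hM; exists (`|M| + 1); first by have := normr_ge0 M; lra.
move=> x; apply: le_trans (hM x) _; apply: ler_wpM2r; first exact: rnorm_ge0.
by have := ler_norm M; lra.
Qed.

End Limits.

Lemma rnorm_complete (R : realType) (H : completeNormedModType R[i]) (u : nat -> H) :
  (forall e : R, 0 < e -> exists N, forall m n, (N <= m)%N -> (N <= n)%N ->
     rnorm (u m - u n) <= e) ->
  exists l, tends u l.
Proof.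
move=> cu; have : cvg (u n @[n --> \oo]).
  apply/cauchy_cvgP/cauchy_exP => /= eps; rewrite ltcE /= => /andP[/eqP Im0 e0].
  have epsE : eps = (complex.Re eps)%:C.
    by rewrite RRe_real// realE lecE /= Im0 eqxx ltW.
  have [|N hN] := cu (complex.Re eps / 2); first lra.
  exists (u N); exists N => // n /= Nn; rewrite -ball_normE /ball_ /=.
  rewrite rnormE epsE ltcR; apply: le_lt_trans (hN _ _ _ Nn) _ => //; lra.
move=> /cvgrPdist_le uc; exists (lim (u n @[n --> \oo])) => e e0.
have [|N _ hN] := uc e%:C; first by rewrite ltcR.
by exists N => n Nn; rewrite rnormB -lecR -rnormE; exact: hN.
Qed.

Section RealForms.
Variables (R : realType) (H : normedModType R[i]) (dot : {dot H for (@Num.conj R[i])}).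
Hypothesis norm_dot : forall x : H, `|x| ^+ 2 = dot x x.
Local Notation ip := (re_dot dot).

Definition ip_symmetric (T : H -> H) := forall x y, ip (T x) y = ip x (T y).

(** On a complex space positivity forces symmetry: the imaginary part of
    <T x, x> vanishes, and polarizing this along x + i y gives the claim. *)
Lemma positive_op_symmetric (T : {linear H -> H}) : positive_op dot T -> ip_symmetric T.
Proof.
move=> posT.
have im0 x : ip (T x) ('i *: x) = 0.
  by rewrite ip_ir; have := posT x; rewrite lecE => /andP[/eqP].
have key x y : ip (T x) ('i *: y) = - ip (T y) ('i *: x).
  have := im0 (x + y); rewrite linearD scalerDr !ipE !im0; lra.
move=> x y; have := key x ('i *: y).
rewrite scale_i_i [T ('i *: y)]linearZ /= !ipE ip_il -ip_ir scale_i_i ipNr (ipC _ x); lra.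
Qed.

Lemma positive_op_ge0 (T : H -> H) x : positive_op dot T -> 0 <= ip (T x) x.
Proof. by move/(_ x); rewrite lecE => /andP[]. Qed.

(** Being C-linear, T commutes with i, so symmetry for the real inner product
    already makes <T x, x> real. *)
Lemma symmetric_positive_op (T : {linear H -> H}) :
  ip_symmetric T -> (forall x, 0 <= ip (T x) x) -> positive_op dot T.
Proof.
move=> symT T0 x; rewrite lecE T0 andbT -ip_ir.
have : ip (T x) ('i *: x) = - ip (T x) ('i *: x).
  by rewrite {1}symT [T ('i *: x)]linearZ /= (ipC _ x) ip_il -ip_ir.
by move=> h; apply/eqP => /=; lra.
Qed.

(** Cauchy-Schwarz for the semi-definite form <T x, y>; T = id is the usual one. *)
Lemma positive_cauchy_schwarz (T : {linear H -> H}) x y :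
  ip_symmetric T -> (forall x, 0 <= ip (T x) x) ->
  ip (T x) y ^+ 2 <= ip (T x) x * ip (T y) y.
Proof.
move=> symT T0; apply: discriminant_le => // t.
have := T0 (x + t%:C *: y).
rewrite linearD linearZ !ipE (symT y x) (ipC _ y (T x)); lra.
Qed.

Lemma ip_cauchy_schwarz x y : `|ip x y| <= rnorm x * rnorm y.
Proof.
rewrite -ler_sqr ?nnegrE ?mulr_ge0 ?rnorm_ge0// real_normK ?num_real// exprMn.
rewrite -!(ipxx norm_dot); apply: (@positive_cauchy_schwarz idfun) => // z.
exact: (ip_ge0 norm_dot).
Qed.

Lemma ip_le x y : ip x y <= rnorm x * rnorm y.
Proof. exact: le_trans (ler_norm _) (ip_cauchy_schwarz x y). Qed.

Lemma rnorm_le_dual x M : 0 <= M -> (forall y, ip x y <= M * rnorm y) -> rnorm x <= M.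
Proof.
move=> M0 h; have := h x; rewrite (ipxx norm_dot) expr2.
have [->//|x0] := eqVneq (rnorm x) 0.
by rewrite ler_pM2r // lt_neqAle eq_sym x0 rnorm_ge0.
Qed.

End RealForms.

(** * Minimization of quadratic energies and adjoints *)

Section LaxMilgram.
Variables (R : realType) (H : completeNormedModType R[i]).
Variable dot : {dot H for (@Num.conj R[i])}.
Hypothesis norm_dot : forall x : H, `|x| ^+ 2 = dot x x.
Local Notation ip := (re_dot dot).

(** The solution minimizes the energy phi x = <G x, x> - 2 f x. With f
    represented by G = id this is Riesz representation; with G = P + t^2 it
    inverts a shifted positive operator. *)
Lemma lax_milgram (G : {linear H -> H}) (f : H -> R) (c M : R) :
  ip_symmetric dot G -> 0 < c -> (forall x : H, c * rnorm x ^+ 2 <= ip (G x) x) ->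
  (forall x y, f (x + y) = f x + f y) -> (forall t x, f (t%:C *: x) = t * f x) ->
  (forall x, `|f x| <= M * rnorm x) ->
  exists z, forall y, ip (G z) y = f y.
Proof.
move=> symG c0 coerc fD fZ fM.
pose phi x := ip (G x) x - 2 * f x.
have phi_lb x : - (M ^+ 2 / c) <= phi x.
  rewrite /phi; have := coerc x; have := ler_norm (f x); have := fM x.
  have : 0 <= (c * rnorm x - M) ^+ 2 / c by rewrite divr_ge0 ?sqr_ge0// ltW.
  have -> : (c * rnorm x - M) ^+ 2 / c = c * rnorm x ^+ 2 - 2 * M * rnorm x + M ^+ 2 / c.
    by field; rewrite gt_eqF.
  lra.
have infP : has_inf (range phi).
  by split; [exists (phi 0), 0|exists (- (M ^+ 2 / c)) => _ [x _ <-]].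
set d := inf (range phi).
have d_le x : d <= phi x by apply: ge_inf; [case: infP|exists x].
have /choice[u uP] : forall n : nat, exists x, phi x < d + n.+1%:R^-1.
  move=> n; have [|_ [x _ <-] ?] := inf_adherent _ infP (eps := n.+1%:R^-1).
    by rewrite invr_gt0 ltr0n.
  by exists x.
have small (e : R) : 0 < e -> exists N, forall n, (N <= n)%N -> n.+1%:R^-1 <= e.
  move=> e0; have [N hN] := ltr_add_invr e0; exists N => n Nn.
  rewrite add0r in hN; apply: le_trans (ltW hN).
  by rewrite lef_pV2 ?posrE ?ltr0n// ler_nat.
(* The parallelogram law for the form of G, at the midpoint of v and w, makes
   every minimizing sequence of phi a Cauchy sequence. *)
have near_min (v w : H) : c * rnorm (v - w) ^+ 2 <= 2 * (phi v - d) + 2 * (phi w - d).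
  pose m := 2^-1 *: (v + w).
  have vwm : v + w = m + m.
    by rewrite -mulr2n -scaler_nat scalerA mulfV ?scale1r ?pnatr_eq0.
  apply: le_trans (coerc _) _; have := d_le m.
  have := congr1 f vwm; have := congr1 (fun x => ip (G x) x) vwm.
  rewrite /phi !fD !linearD linearN /= !ipE (symG w v) (ipC _ w (G v)).
  move: (f v) (f w) (f m) (ip (G v) v) (ip (G v) w) (ip (G w) w) (ip (G m) m) => *; lra.
have [z uz] : exists z, tends u z.
  apply: rnorm_complete => e e0.
  have [|N hN] := small (c * e ^+ 2 / 4); first by rewrite !mulr_gt0// invr_gt0.
  exists N => m n /hN hm /hN hn.
  rewrite -ler_sqr ?nnegrE ?rnorm_ge0 ?(ltW e0)// -(ler_pM2l c0).
  have phi_small k : k.+1%:R^-1 <= c * e ^+ 2 / 4 -> phi (u k) <= d + c * e ^+ 2 / 4.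
    by move=> hk; apply: le_trans (ltW (uP k)) _; rewrite lerD2l.
  apply: le_trans (near_min _ _) _.
  have := phi_small _ hm; have := phi_small _ hn; lra.
exists z => y.
suff : (ip (G z) y - f y) ^+ 2 <= 0 * ip (G y) y.
  by rewrite mul0r exprn_even_le0//= subr_eq0 => /eqP.
have Gy0 : 0 <= ip (G y) y by apply: le_trans (coerc y); rewrite mulr_ge0 ?sqr_ge0// ltW.
apply: discriminant_le => // t; apply/ler_addgt0Pl => e e0.
have e2 : 0 < e / 2 by lra.
set k := 2 * `|t| * rnorm (G y) + 1.
have k0 : 0 <= 2 * `|t| * rnorm (G y) by rewrite !mulr_ge0 ?rnorm_ge0.
have k1 : 0 < k by rewrite /k; lra.
have [N hN] := small _ e2; have [N' hN'] := uz _ (divr_gt0 e2 k1).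
set n := maxn N N'; have hn := hN n (leq_maxl _ _); have hn' := hN' n (leq_maxr _ _).
have : `|2 * t * (ip (G (u n)) y - ip (G z) y)| <= e / 2.
  rewrite !symG -ipBl normrM (normrM 2) ger0_norm//.
  have := ip_cauchy_schwarz norm_dot (u n - z) (G y).
  move=> /(ler_wpM2l (_ : 0 <= 2 * `|t|)) => /(_ ltac:(by rewrite mulr_ge0)).
  move=> /le_trans; apply.
  rewrite mulrCA; apply: (@le_trans _ _ (e / 2 / k * (2 * `|t| * rnorm (G y)))).
    by rewrite ler_wpM2r.
  by rewrite mulrAC ler_pdivrMr// ler_pM2l// /k; lra.
rewrite ler_norml => /andP[_]; have := d_le (u n + t%:C *: y).
have : phi (u n) <= d + e / 2 by apply: le_trans (ltW (uP n)) _; rewrite lerD2l.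
rewrite /phi fD fZ linearD [G (_ *: _)]linearZ /= !ipE (symG y (u n)) (ipC _ y (G _)).
lra.
Qed.

Lemma riesz (f : H -> R) (M : R) :
  (forall x y, f (x + y) = f x + f y) -> (forall t x, f (t%:C *: x) = t * f x) ->
  (forall x, `|f x| <= M * rnorm x) -> exists z, forall y, ip y z = f y.
Proof.
move=> fD fZ fM; have [|||z hz] := @lax_milgram idfun f 1 M _ _ _ fD fZ fM.
- by move=> x y.
- exact: ltr01.
- by move=> x; rewrite (ipxx norm_dot) mul1r.
by exists z => y; rewrite ipC hz.
Qed.

End LaxMilgram.

Section Adjoint.
Variables (R : realType) (H : completeNormedModType R[i]).
Variable dot : {dot H for (@Num.conj R[i])}.
Hypothesis norm_dot : forall x : H, `|x| ^+ 2 = dot x x.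
Local Notation ip := (re_dot dot).

Lemma ip_dot (x y x' y' : H) :
  ip x y = ip x' y' -> ip ('i *: x) y = ip ('i *: x') y' -> dot x y = dot x' y'.
Proof. by rewrite !ip_il /re_dot; case: (dot x y) (dot x' y') => a b [a' b'] /= -> /oppr_inj ->. Qed.

Lemma adjoint_exists (T : {linear H -> H}) : bounded_op T ->
  exists S : {linear H -> H}, bounded_op S /\ forall x y, dot (T x) y = dot x (S y).
Proof.
move=> /bounded_op_pos[M M0 TM].
have /choice[S0 S0P] : forall y, exists z, forall x, ip x z = ip (T x) y.
  move=> y; apply: (@riesz _ _ _ norm_dot _ (M * rnorm y)).
  - by move=> a b; rewrite linearD ipDl.
  - by move=> t a; rewrite [T _]linearZ ipZl.
  - move=> x; apply: le_trans (ip_cauchy_schwarz norm_dot _ _) _.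
    by rewrite mulrAC; apply: ler_wpM2r; rewrite ?rnorm_ge0.
have S0dot x y : dot (T x) y = dot x (S0 y).
  by apply: ip_dot; rewrite S0P// [T ('i *: _)]linearZ.
have S0lin : linear S0.
  move=> a x y; apply: (ip_nondeg norm_dot) => z.
  rewrite /re_dot; congr complex.Re.
  by rewrite -S0dot !(linearDr dot) !(linearZr_LR dot) /= !S0dot.
pose Sl := GRing.isLinear.Build _ _ _ _ S0 S0lin.
pose S : {linear H -> H} := HB.pack S0 Sl.
exists S; split=> //; exists M => x.
apply: (rnorm_le_dual norm_dot); first by rewrite mulr_ge0 ?rnorm_ge0// ltW.
move=> y; rewrite ipC S0P; apply: le_trans (ip_le norm_dot _ _) _.
by rewrite mulrAC; apply: ler_wpM2r; rewrite ?rnorm_ge0.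
Qed.

Lemma adjoint_spec (T : {linear H -> H}) : bounded_op T ->
  bounded_op (adjoint dot T) /\ forall x y, ip (T x) y = ip x (adjoint dot T y).
Proof.
move=> /adjoint_exists/cid[S hS]; 
have [bS dS] : bounded_op (adjoint dot T) /\ forall x y, dot (T x) y = dot x (adjoint dot T y).
  exact: (@getI _ [set S : {linear H -> H} |
    bounded_op S /\ forall x y : H, dot (T x) y = dot x (S y)] S hS).
split; [exact: bS|by move=> x y; rewrite /re_dot dS].
Qed.

Lemma adjointK (T : {linear H -> H}) x : bounded_op T ->
  adjoint dot (adjoint dot T) x = T x.
Proof.
move=> /adjoint_spec[/adjoint_spec[_ h'] h]; apply: (ip_nondeg norm_dot) => z.
by rewrite -h' ipC -h ipC.
Qed.

End Adjoint.

(** * Positive square roots *)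

Section SquareRoot.
Variables (R : realType) (H : completeNormedModType R[i]).
Variable dot : {dot H for (@Num.conj R[i])}.
Hypothesis norm_dot : forall x : H, `|x| ^+ 2 = dot x x.
Local Notation ip := (re_dot dot).

Lemma linear_of_fun (f : H -> H) : linear f -> exists g : {linear H -> H}, g = f :> (H -> H).
Proof.
move=> flin; pose fl := GRing.isLinear.Build _ _ _ _ f flin.
pose g : {linear H -> H} := HB.pack f fl.
by exists g.
Qed.

Lemma ip_tends (u v : nat -> H) l m (x y : H) : tends u l -> tends v m ->
  (forall n, ip (u n) y = ip x (v n)) -> ip l y = ip x m.
Proof.
move=> ul vm uv; apply/eqP; rewrite -subr_eq0 -normr_eq0 eq_le normr_ge0 andbT.
apply/ler_addgt0Pl => e e0; rewrite addr0.
have k0 : 0 <= rnorm x + rnorm y by rewrite addr_ge0 ?rnorm_ge0.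
have k1 : 0 < rnorm x + rnorm y + 1 by lra.
have [N hN] := ul _ (divr_gt0 e0 k1); have [N' hN'] := vm _ (divr_gt0 e0 k1).
set n := maxn N N'; have hn := hN n (leq_maxl _ _); have hn' := hN' n (leq_maxr _ _).
have -> : ip l y - ip x m = ip x (v n - m) - ip (u n - l) y.
  by rewrite !ipE uv; lra.
apply: le_trans (ler_normB _ _) _.
have h1 := ip_cauchy_schwarz norm_dot x (v n - m).
have h2 := ip_cauchy_schwarz norm_dot (u n - l) y.
apply: le_trans (lerD h1 h2) _.
have : rnorm x * rnorm (v n - m) <= rnorm x * (e / (rnorm x + rnorm y + 1)).
  by rewrite ler_wpM2l ?rnorm_ge0.
have : rnorm (u n - l) * rnorm y <= e / (rnorm x + rnorm y + 1) * rnorm y.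
  by rewrite ler_wpM2r ?rnorm_ge0.
move=> h3 h4; apply: le_trans (lerD h4 h3) _.
rewrite (mulrC (rnorm x)) -mulrDr mulrAC ler_pdivrMr// ler_pM2l//; lra.
Qed.

(** The iteration sqrt_iter below, run on the scalar 1 in place of Z. As all
    the coefficients in it are positive, it dominates the norms of the iterates
    and of their increments. *)
Fixpoint sqrt_majorant (n : nat) : R :=
  if n is k.+1 then 2^-1 * (1 + sqrt_majorant k ^+ 2) else 0.

Lemma sqrt_majorant_itv n : 0 <= sqrt_majorant n <= 1.
Proof.
elim: n => [|n /andP[h0 h1]] /=; first by rewrite lexx ler01.
have : sqrt_majorant n ^+ 2 <= 1 by rewrite exprn_ile1.
have := sqr_ge0 (sqrt_majorant n); move: (_ ^+ 2) => b b0 b1; lra.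
Qed.

Lemma sqrt_majorant_nondecreasing m n : (m <= n)%N -> sqrt_majorant m <= sqrt_majorant n.
Proof.
apply: (@homo_leq _ sqrt_majorant <=%R) => [//|y x z|k]; first exact: le_trans.
have : 0 <= (1 - sqrt_majorant k) ^+ 2 by exact: sqr_ge0.
by rewrite /= sqrrB; lra.
Qed.

Lemma sqrt_majorant_cauchy (e : R) : 0 < e ->
  exists N, forall m n, (N <= m)%N -> (N <= n)%N ->
    sqrt_majorant m - sqrt_majorant n <= e.
Proof.
move=> e0; have supP : has_sup (range sqrt_majorant).
  by split; [exists (sqrt_majorant 0), 0%N|exists 1 => _ [n _ <-]; case/andP: (sqrt_majorant_itv n)].
have [_ [N _ <-] hN] := sup_adherent e0 supP; exists N => m n _ Nn.
have : sqrt_majorant m <= sup (range sqrt_majorant).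
  by apply: sup_upper_bound => //; exists m.
by have := sqrt_majorant_nondecreasing Nn; lra.
Qed.

(** A fixed point Y of this recursion satisfies 2 Y = Z + Y^2, that is
    (1 - Y)^2 = 1 - Z: the limit is the binomial series of 1 - (1 - Z)^(1/2). *)
Fixpoint sqrt_iter (Z : H -> H) (n : nat) (x : H) : H :=
  if n is k.+1 then (2^-1 : R)%:C *: (Z x + sqrt_iter Z k (sqrt_iter Z k x)) else 0.

Section Iteration.
Variable Z : {linear H -> H}.
Hypothesis Zsym : ip_symmetric dot Z.
Hypothesis Z_contr : forall x, rnorm (Z x) <= rnorm x.
Local Notation Y := (sqrt_iter Z).
Local Notation a := sqrt_majorant.

Lemma sqrt_iter_linear n : linear (Y n).
Proof.
elim: n => [|n IH] b x y /=; first by rewrite scaler0 addr0.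
by rewrite !IH linearP addrACA -scalerDr [LHS]scalerDr !scalerA mulrC.
Qed.

Lemma sqrt_iterB n x y : Y n (x - y) = Y n x - Y n y.
Proof. by rewrite -scaleN1r addrC sqrt_iter_linear scaleN1r addrC. Qed.

Lemma sqrt_iter_symmetric n : ip_symmetric dot (Y n).
Proof.
elim: n => [|n IH] x y /=; first by rewrite ip0l ipC ip0l.
by rewrite !ipE Zsym !IH.
Qed.

Lemma sqrt_iter_bound n x : rnorm (Y n x) <= a n * rnorm x.
Proof.
elim: n x => [|n IH] x /=; first by rewrite rnorm0 mul0r.
rewrite rnormZr ger0_norm ?invr_ge0// -mulrA ler_pM2l ?invr_gt0//.
apply: le_trans (rnormD _ _) _; rewrite mulrDl mul1r lerD ?Z_contr//.
apply: le_trans (IH _) _; rewrite expr2 -mulrA ler_wpM2l ?IH//.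
by case/andP: (sqrt_majorant_itv n).
Qed.

(** Splitting Y_(n+1)^2 - Y_n^2 as Y_(n+1) (Y_(n+1) - Y_n) + (Y_(n+1) - Y_n) Y_n
    mirrors the factorization of the scalar difference a_(n+1)^2 - a_n^2. *)
Lemma sqrt_iter_step n x : rnorm (Y n.+1 x - Y n x) <= (a n.+1 - a n) * rnorm x.
Proof.
elim: n x => [|n IH] x.
  by rewrite [Y 0 x]/= [a 0]/= !subr0; exact: sqrt_iter_bound.
have -> : Y n.+2 x - Y n.+1 x = (2^-1 : R)%:C *:
    (Y n.+1 (Y n.+1 x - Y n x) + (Y n.+1 (Y n x) - Y n (Y n x))).
  by rewrite sqrt_iterB addrA subrK [Y n.+2 x]/= {2}[Y n.+1 x]/= -scalerBr opprD addrACA subrr add0r.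
have /andP[an0 _] := sqrt_majorant_itv n; have /andP[an1 _] := sqrt_majorant_itv n.+1.
have d0 : 0 <= a n.+1 - a n by rewrite subr_ge0 sqrt_majorant_nondecreasing.
rewrite rnormZr ger0_norm ?invr_ge0//.
apply: le_trans (_ : 2^-1 * (a n.+1 * ((a n.+1 - a n) * rnorm x) +
  (a n.+1 - a n) * (a n * rnorm x)) <= _).
  rewrite ler_pM2l ?invr_gt0//; apply: le_trans (rnormD _ _) _; apply: lerD.
    by apply: le_trans (sqrt_iter_bound _ _) _; rewrite ler_wpM2l.
  by apply: le_trans (IH _) _; rewrite ler_wpM2l ?sqrt_iter_bound.
have aE k : a k.+1 = 2^-1 * (1 + a k ^+ 2) by [].
have -> : a n.+2 - a n.+1 = 2^-1 * (a n.+1 ^+ 2 - a n ^+ 2).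
  by rewrite (aE n.+1) {2}(aE n); lra.
by move: (a n.+1) (a n) (rnorm x) => b c d; lra.
Qed.

Lemma sqrt_iter_dist m n x : (n <= m)%N -> rnorm (Y m x - Y n x) <= (a m - a n) * rnorm x.
Proof.
elim: m => [|m IH]; first by rewrite leqn0 => /eqP ->; rewrite !subrr rnorm0 mul0r.
rewrite leq_eqVlt => /predU1P[->|nm]; first by rewrite !subrr rnorm0 mul0r.
apply: le_trans (rnorm_triangle (Y m x) _ _) _.
apply: le_trans (lerD (sqrt_iter_step m x) (IH nm)) _.
by rewrite -mulrDl addrA subrK.
Qed.

(** The increments are summable because those of the majorant are, so Y_n
    converges pointwise to a symmetric contraction K, and P = 1 - K. *)
Lemma sqrt_contraction : exists P : {linear H -> H},
  [/\ bounded_op P, positive_op dot P & forall x, P (P x) = x - Z x].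
Proof.
have /choice[L YL] : forall x, exists l, tends (fun n => Y n x) l.
  move=> x; apply: rnorm_complete => e e0.
  have x0 := rnorm_ge0 x; have x1 : 0 < rnorm x + 1 by lra.
  have [N hN] := sqrt_majorant_cauchy (divr_gt0 e0 x1).
  suff dist m n : (N <= m)%N -> (N <= n)%N -> (n <= m)%N -> rnorm (Y m x - Y n x) <= e.
    exists N => m n Nm Nn; have [nm|/ltnW mn] := leqP n m; first exact: dist.
    by rewrite rnormB; exact: dist.
  move=> Nm Nn nm; apply: le_trans (sqrt_iter_dist x nm) _.
  apply: le_trans (ler_wpM2r x0 (hN _ _ Nm Nn)) _.
  by rewrite mulrAC ler_pdivrMr// ler_pM2l//; lra.
have Llin : linear L.
  move=> b x y; apply: tends_unique (YL _) _.
  have := tendsD (tendsZ b (YL x)) (YL y); congr tends.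
  by apply/funext => n; rewrite sqrt_iter_linear.
have [K KE] := linear_of_fun Llin.
have YK x : tends (fun n => Y n x) (K x) by rewrite KE; exact: YL.
have Y_contr n x : rnorm (Y n x) <= rnorm x.
  apply: le_trans (sqrt_iter_bound _ _) _; rewrite ler_piMl ?rnorm_ge0//.
  by case/andP: (sqrt_majorant_itv n).
have K_contr x : rnorm (K x) <= rnorm x.
  by have := tends_bound (YK x) (x := 0) (M := rnorm x); rewrite subr0; apply => n; rewrite subr0.
have Ksym : ip_symmetric dot K.
  by move=> x y; apply: ip_tends (YK x) (YK y) _ => n; rewrite sqrt_iter_symmetric.
have YYK x : tends (fun n => Y n (Y n x)) (K (K x)).
  move=> e e0; have e2 : 0 < e / 2 by lra.
  have [N hN] := YK x _ e2; have [N' hN'] := YK (K x) _ e2.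
  exists (maxn N N') => n; rewrite geq_max => /andP[/hN h /hN' h'].
  apply: le_trans (rnorm_triangle (Y n (K x)) _ _) _; rewrite -sqrt_iterB.
  by have := Y_contr n (Y n x - K x); lra.
have KE2 x : K x = (2^-1 : R)%:C *: (Z x + K (K x)).
  apply: (@tends_unique _ _ (fun n => Y n.+1 x)).
    by move=> e /(YK x)[N hN]; exists N => n Nn; apply: hN; exact: leqW.
  exact: tendsZ (tendsD (@tends_cst _ _ _) (YYK x)).
have Plin : linear (fun x => x - K x).
  by move=> b x y; rewrite linearP scalerBr opprD addrACA.
have [P PE] := linear_of_fun Plin.
exists P; split.
- exists 2 => x; rewrite PE; apply: le_trans (rnormD _ _) _; rewrite rnormN.
  by have := K_contr x; lra.
- apply: symmetric_positive_op => [x y|x]; rewrite PE.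
    by rewrite !ipE Ksym.
  rewrite ipBl subr_ge0; apply: le_trans (ip_le norm_dot _ _) _.
  by rewrite (ipxx norm_dot) expr2 ler_wpM2r ?rnorm_ge0.
- move=> x; rewrite PE linearB /= opprB.
  have /(congr1 (fun z => 2 *: z)) := KE2 x.
  have -> (z : H) : 2 *: ((2^-1 : R)%:C *: z) = z.
    by rewrite scalerA fmorphV rmorph_nat mulfV ?pnatr_eq0// scale1r.
  rewrite scaler_nat mulr2n => h.
  have -> : K (K x) = K x + K x - Z x by rewrite h addrC addKr.
  by rewrite (addrAC _ (- Z x)) addrK addrA subrK.
Qed.

End Iteration.

(** With ||A||, ||S|| <= M, the operator 1 - S A / M^2 is a contraction: expanding
    ||x - S A x / M^2||^2, the quadratic term is absorbed by the linear one. *)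
Lemma positive_sqrt_exists (S A : {linear H -> H}) : bounded_op A -> bounded_op S ->
  (forall x y, ip (A x) y = ip x (S y)) ->
  exists P : {linear H -> H},
  [/\ bounded_op P, positive_op dot P & forall x, P (P x) = S (A x)].
Proof.
move=> /bounded_op_pos[M1 M10 AM1] /bounded_op_pos[M2 M20 SM2] AS.
pose M := M1 + M2; have M0 : 0 < M by rewrite addr_gt0.
have SM x : rnorm (S x) <= M * rnorm x.
  by apply: le_trans (SM2 _) _; rewrite ler_wpM2r ?rnorm_ge0// lerDr ltW.
pose c := (M ^+ 2)^-1; have c0 : 0 < c by rewrite invr_gt0 exprn_gt0.
have Zlin : linear (fun x => x - c%:C *: S (A x)).
  move=> b x y; rewrite [A _]linearP [S _]linearP scalerDr opprD addrACA.
  by rewrite scalerBr !scalerA mulrC.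
have [Z ZE] := linear_of_fun Zlin.
have SA x y : ip (S x) y = ip x (A y) by rewrite ipC -AS ipC.
have [| |P0 [bP0 pP0 P0P0]] := @sqrt_contraction Z.
- by move=> x y; rewrite ZE !ipE SA AS.
- move=> x; rewrite ZE -ler_sqr ?nnegrE ?rnorm_ge0// -!(ipxx norm_dot).
  rewrite !ipE (ipC _ x (S _)) !(SA _ x) !(ipxx norm_dot).
  have : c * rnorm (S (A x)) ^+ 2 <= rnorm (A x) ^+ 2.
    rewrite mulrC ler_pdivrMr ?exprn_gt0// mulrC -exprMn ler_sqr ?nnegrE ?mulr_ge0 ?rnorm_ge0 ?SM//.
    exact: ltW.
  move=> /(ler_wpM2l (ltW c0)); have : 0 <= c * rnorm (A x) ^+ 2 by rewrite mulr_ge0 ?sqr_ge0// ltW.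
  lra.
have Plin : linear (fun x => M%:C *: P0 x).
  by move=> b x y; rewrite linearP scalerDr !scalerA mulrC.
have [P PE] := linear_of_fun Plin; exists P; split.
- case: bP0 => K hK; exists (M * K) => x.
  by rewrite PE rnormZr gtr0_norm// -mulrA ler_pM2l.
- move=> x; rewrite PE linearZl_LR; apply: mulr_ge0; [by rewrite ler0c ltW|exact: pP0].
- move=> x; rewrite PE linearZ /= P0P0 ZE opprB addrC subrK !scalerA.
  rewrite -!rmorphM /= -expr2 mulfV ?scale1r// gt_eqF// exprn_gt0//.
Qed.

Lemma abs_op_spec (A : {linear H -> H}) : bounded_op A ->
  [/\ bounded_op (abs_op dot A), positive_op dot (abs_op dot A) &
      forall x, abs_op dot A (abs_op dot A x) = adjoint dot A (A x)].
Proof.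
move=> bA; have [bS AS] := adjoint_spec norm_dot bA.
have /cid[P hP] := positive_sqrt_exists bA bS AS.
exact: (@getI _ [set P : {linear H -> H} | [/\ bounded_op P, positive_op dot P &
            forall x : H, P (P x) = adjoint dot A (A x)]] P hP).
Qed.

End SquareRoot.

(** * Operator norm *)

Section OperatorNorm.
Variables (R : realType) (H : normedModType R[i]).

Lemma opnorm_ub (T : H -> H) (x : H) :
  bounded_op T -> rnorm x <= 1 -> rnorm (T x) <= opnorm T.
Proof.
move=> /bounded_op_pos[M M0 TM] x1; apply: sup_upper_bound; last by exists x.
split; first by exists (rnorm (T x)), x.
exists M => _ [y /= y1 <-]; apply: le_trans (TM _) _.
by rewrite -[leRHS]mulr1 ler_pM2l.
Qed.

Lemma opnorm_lub (T : H -> H) (M : R) :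
  (forall x, rnorm x <= 1 -> rnorm (T x) <= M) -> opnorm T <= M.
Proof.
move=> TM; apply: ge_sup => [|_ [x /= x1 <-]]; last exact: TM.
by exists (rnorm (T 0)), 0 => //=; rewrite rnorm0.
Qed.

Lemma opnorm_ge0 (T : H -> H) : bounded_op T -> 0 <= opnorm T.
Proof.
move=> bT; apply: le_trans (opnorm_ub bT (x := 0) _); first exact: rnorm_ge0.
by rewrite rnorm0.
Qed.

Lemma le_opnorm (T : {linear H -> H}) (x : H) :
  bounded_op T -> rnorm (T x) <= opnorm T * rnorm x.
Proof.
move=> bT; have [->|x0] := eqVneq x 0; first by rewrite linear0 !rnorm0 mulr0.
have xp : 0 < rnorm x.
  by rewrite lt_neqAle rnorm_ge0 andbT eq_sym; apply: contraNneq x0 => /rnorm_eq0 ->.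
have := @opnorm_ub T ((rnorm x)^-1%:C *: x) bT.
rewrite [T _]linearZ /= !rnormZr gtr0_norm ?invr_gt0// mulVf ?gt_eqF// => /(_ (lexx _)).
by rewrite mulrC ler_pdivrMr.
Qed.

End OperatorNorm.

(** * Mixed Schwarz inequality *)

Section MixedSchwarz.
Variables (R : realType) (H : completeNormedModType R[i]).
Variable dot : {dot H for (@Num.conj R[i])}.
Hypothesis norm_dot : forall x : H, `|x| ^+ 2 = dot x x.
Local Notation ip := (re_dot dot).

(** Uniqueness for the Sylvester equation Q X + X P = 0 with P, Q >= 0. If a
    unit vector u maximizes ||X u|| = s, then X' X u = s^2 u, so the equation gives
    <Q X u, X u> + s^2 <P u, u> = 0; both terms vanish, hence P u = 0, and X u = 0
    because X is dominated by P. The proof quantifies this for approximate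
    maximizers, since the norm need not be attained. *)
Lemma sylvester_eq0 (P Q X X' : {linear H -> H}) (C : R) :
  bounded_op P -> positive_op dot P -> positive_op dot Q -> bounded_op X ->
  (forall x y, ip (X x) y = ip x (X' y)) ->
  (forall x, Q (X x) = - X (P x)) ->
  (forall x, rnorm (X x) <= C * rnorm (P x)) ->
  forall x, X x = 0.
Proof.
move=> bP pP pQ bX XX' QX XC.
have [m m0 Pm] := bounded_op_pos bP.
have s0 := opnorm_ge0 bX; set s := opnorm X in s0.
have Xs x : rnorm (X x) <= s * rnorm x by exact: le_opnorm.
have X's x : rnorm (X' x) <= s * rnorm x.
  apply: (rnorm_le_dual norm_dot); first by rewrite mulr_ge0 ?rnorm_ge0.
  move=> y; rewrite ipC -XX'; apply: le_trans (ip_le norm_dot _ _) _.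
  by rewrite mulrAC ler_wpM2r ?rnorm_ge0.
suff s_eq0 : s <= 0.
  move=> x; apply: rnorm_eq0; apply/eqP; rewrite eq_le rnorm_ge0 andbT.
  by apply: le_trans (Xs x) _; rewrite mulr_le0_ge0 ?rnorm_ge0.
rewrite leNgt; apply/negP => sp.
(* Where X almost attains its norm s, X' (X x) is close to s^2 x, so <X P x, X x>
   is close to s^2 <P x, x>; but it equals - <Q X x, X x> <= 0. *)
have near (t : R) (x : H) : 0 <= t -> rnorm x <= 1 -> s ^+ 2 - t ^+ 2 <= rnorm (X x) ^+ 2 ->
    s * ip (P x) x <= m * t.
  move=> t0 x1 xt; set E := X' (X x) - (s ^+ 2)%:C *: x.
  have x2 : rnorm x ^+ 2 <= 1 by rewrite exprn_ile1// rnorm_ge0.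
  have Est : rnorm E <= s * t.
    rewrite -ler_sqr ?nnegrE ?rnorm_ge0 ?mulr_ge0// -(ipxx norm_dot) /E.
    rewrite !ipE (ipC _ (X' (X x)) x) -!(XX' x) !(ipxx norm_dot).
    have h : rnorm (X' (X x)) ^+ 2 <= s ^+ 2 * rnorm (X x) ^+ 2.
      by rewrite -exprMn ler_sqr ?nnegrE ?mulr_ge0 ?rnorm_ge0.
    have h1 := ler_wpM2l (sqr_ge0 s) xt.
    have h2 := ler_wpM2l (sqr_ge0 (s ^+ 2)) x2.
    rewrite exprMn; move: h h1 h2; move: (rnorm (X' _) ^+ 2) (rnorm (X x) ^+ 2) (rnorm x ^+ 2).
    by move=> p q u; rewrite !expr2 => *; lra.
  have : 0 <= ip (Q (X x)) (X x) by exact: positive_op_ge0.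
  rewrite QX ipNl XX'.
  have -> : X' (X x) = E + (s ^+ 2)%:C *: x by rewrite /E subrK.
  rewrite ipDr ipZr => h.
  have h1 := ip_cauchy_schwarz norm_dot (P x) E; rewrite ler_norml in h1.
  have h2 : rnorm (P x) * rnorm E <= m * (s * t).
    apply: ler_pM; rewrite ?rnorm_ge0//; apply: le_trans (Pm _) _.
    by rewrite -[leRHS]mulr1 ler_pM2l.
  rewrite -(ler_pM2l sp) mulrA -expr2 mulrCA.
  by case/andP: h1 => *; lra.
have P4 x : rnorm x <= 1 -> rnorm (P x) ^+ 4 <= m ^+ 3 * ip (P x) x.
  move=> x1; have Pm1 : rnorm (P x) <= m.
    by apply: le_trans (Pm _) _; rewrite -[leRHS]mulr1 ler_pM2l.
  have := positive_cauchy_schwarz x (P x) (positive_op_symmetric pP)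
    (fun z => positive_op_ge0 z pP).
  rewrite (ipxx norm_dot) -exprM mulrC => /le_trans; apply.
  rewrite ler_wpM2r ?positive_op_ge0//; apply: le_trans (ip_le norm_dot _ _) _.
  rewrite exprSr expr2; apply: ler_pM; rewrite ?rnorm_ge0//.
  by apply: le_trans (Pm _) _; rewrite ler_pM2l.
(* The constants are such that near, P4 and XC together give
   s ||X x||^4 <= K t, which t small against s^5 / K contradicts. *)
pose K := C ^+ 4 * m ^+ 4.
have K0 : 0 <= K by rewrite mulr_ge0 ?exprn_even_ge0.
pose t := Num.min (s / 2) (s ^+ 5 / (2 * (K + 1))).
have s5 : 0 < s ^+ 5 by rewrite exprn_gt0.
have tp : 0 < t by rewrite lt_min !divr_gt0//; lra.
have ts : t <= s / 2 by rewrite ge_min lexx.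
have Kt : K * t <= s ^+ 5 / 2.
  apply: (@le_trans _ _ ((K + 1) * (s ^+ 5 / (2 * (K + 1))))).
    by apply: ler_pM; rewrite ?(ltW tp)//; [lra|rewrite ge_min lexx orbT].
  by rewrite le_eqVlt; apply/orP; left; apply/eqP; field; lra.
have t2s : t ^+ 2 <= s ^+ 2 / 4.
  rewrite [leRHS](_ : _ = (s / 2) ^+ 2); last by field.
  by rewrite ler_sqr ?nnegrE ?(ltW tp)//; lra.
have [x x1 xt] : exists2 x, rnorm x <= 1 & s ^+ 2 - t ^+ 2 <= rnorm (X x) ^+ 2.
  have supP : has_sup [set rnorm (X x) | x in [set x : H | rnorm x <= 1]].
    split; first by exists (rnorm (X 0)), 0 => //=; rewrite rnorm0.
    by exists s => _ [x /= x1 <-]; exact: opnorm_ub.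
  have e0 : 0 < t ^+ 2 / (2 * s) by rewrite divr_gt0 ?exprn_gt0//; lra.
  have [_ [x /= x1 <-] hx] := sup_adherent e0 supP; exists x => //.
  rewrite -/(opnorm X) -/s in hx; apply: ltW.
  have h0 : 0 <= s - t ^+ 2 / (2 * s).
    by rewrite subr_ge0 ler_pdivrMr ?mulr_gt0// expr2 in t2s *; nra.
  apply: (@le_lt_trans _ _ ((s - t ^+ 2 / (2 * s)) ^+ 2)).
    have -> : (s - t ^+ 2 / (2 * s)) ^+ 2 = s ^+ 2 - t ^+ 2 + (t ^+ 2 / (2 * s)) ^+ 2.
      by field; rewrite gt_eqF.
    by rewrite lerDl sqr_ge0.
  by rewrite ltr_sqr ?nnegrE ?rnorm_ge0.
have hP := near t x (ltW tp) x1 xt.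
have X4 : rnorm (X x) ^+ 4 <= C ^+ 4 * rnorm (P x) ^+ 4.
  rewrite -exprMn; apply: lerXn2r; rewrite ?nnegrE ?rnorm_ge0//.
  by apply: le_trans (XC x); exact: rnorm_ge0.
have hX : 9 / 16 * s ^+ 4 <= rnorm (X x) ^+ 4.
  rewrite (_ : 9 / 16 * s ^+ 4 = (3 / 4 * s ^+ 2) ^+ 2); last by field.
  rewrite (exprM _ 2 2) ler_sqr ?nnegrE ?sqr_ge0 ?mulr_ge0 ?sqr_ge0//; first lra.
have : s * rnorm (X x) ^+ 4 <= K * t.
  apply: le_trans (_ : s * (C ^+ 4 * (m ^+ 3 * ip (P x) x)) <= _).
    rewrite ler_pM2l//; apply: le_trans X4 _.
    by rewrite ler_wpM2l ?exprn_even_ge0// P4.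
  have -> : s * (C ^+ 4 * (m ^+ 3 * ip (P x) x)) = C ^+ 4 * m ^+ 3 * (s * ip (P x) x) by ring.
  have -> : K * t = C ^+ 4 * m ^+ 3 * (m * t) by rewrite /K; ring.
  by apply: ler_wpM2l => //; apply: mulr_ge0; [exact: exprn_even_ge0|exact/exprn_ge0/ltW].
move=> /le_trans/(_ Kt) h; move: hX; rewrite -(ler_pM2l sp) => /le_trans/(_ h).
move: s5; rewrite (exprS s 4); move: (s ^+ 4) => u; lra.
Qed.

Variables A S P Q : {linear H -> H}.
Hypothesis bA : bounded_op A.
Hypothesis AS : forall x y, ip (A x) y = ip x (S y).
Hypotheses (bP : bounded_op P) (bQ : bounded_op Q).
Hypotheses (pP : positive_op dot P) (pQ : positive_op dot Q).
Hypotheses (PP : forall x, P (P x) = S (A x)) (QQ : forall x, Q (Q x) = A (S x)).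

Lemma rnorm_sqrt x : rnorm (P x) = rnorm (A x).
Proof.
apply/eqP; rewrite -(@eqrXn2 _ 2) ?rnorm_ge0// -!(ipxx norm_dot).
by rewrite AS -PP (positive_op_symmetric pP).
Qed.

(** X = A P - Q A solves Q X + X P = Q A P - A S A + A S A - Q A P = 0. *)
Lemma sqrt_intertwine x : A (P x) = Q (A x).
Proof.
have Psym := positive_op_symmetric pP; have Qsym := positive_op_symmetric pQ.
have [a a0 Aa] := bounded_op_pos bA; have [p p0 Pp] := bounded_op_pos bP.
have [q q0 Qq] := bounded_op_pos bQ.
have [X XE] : exists X : {linear H -> H}, X = (fun x => A (P x) - Q (A x)) :> (H -> H).
  apply: linear_of_fun => b y z.
  by rewrite [P _]linearP !(linearP A) (linearP Q) scalerBr opprD addrACA.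
have [X' X'E] : exists X' : {linear H -> H}, X' = (fun y => P (S y) - S (Q y)) :> (H -> H).
  apply: linear_of_fun => b y z.
  by rewrite [Q _]linearP !(linearP S) (linearP P) scalerBr opprD addrACA.
have XC y : rnorm (X y) <= (a + q) * rnorm (P y).
  rewrite XE; apply: le_trans (rnormD _ _) _; rewrite rnormN mulrDl lerD//.
  by rewrite rnorm_sqrt.
apply/eqP; rewrite -subr_eq0; apply/eqP.
have /= := @sylvester_eq0 P Q X X' (a + q) bP pP pQ _ _ _ XC x.
rewrite XE; apply.
- exists ((a + q) * p) => y.
  have := XC y; rewrite XE => /le_trans; apply.
  by rewrite -mulrA ler_wpM2l// addr_ge0// ltW.
- by move=> y z; rewrite X'E !ipE AS Psym Qsym AS.
- by move=> y; rewrite (linearB Q) QQ PP opprB.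
Qed.

(** The mixed Schwarz inequality of Kato, for P = |A| and Q = |A^*|. If x = P z,
    then <A x, y> = <Q A z, y> by intertwining; Cauchy-Schwarz for Q applies, and
    <Q A z, A z> = <A P z, A z> = <P x, x>. *)
Lemma mixed_schwarz x y : ip (A x) y ^+ 2 <= ip (P x) x * ip (Q y) y.
Proof.
have Psym := positive_op_symmetric pP; have Qsym := positive_op_symmetric pQ.
have [m m0 Pm] := bounded_op_pos bP.
have P0 z := positive_op_ge0 z pP; have Q0 z := positive_op_ge0 z pQ.
set a := ip (P x) x; set b := ip (Q y) y.
have a0 : 0 <= a by exact: P0.
have b0 : 0 <= b by exact: Q0.
have ab0 : 0 <= a * b by exact: mulr_ge0.
rewrite -[leRHS]sqr_sqrtr// -(real_normK (num_real (ip (A x) y))).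
rewrite ler_sqr ?nnegrE ?sqrtr_ge0//; apply/ler_addgt0Pl => e e0.
have k0 : 0 <= Num.sqrt a * rnorm y by rewrite mulr_ge0 ?sqrtr_ge0 ?rnorm_ge0.
have k1 : 0 < Num.sqrt a * rnorm y + 1 by lra.
pose t := e / (Num.sqrt a * rnorm y + 1).
have t0 : 0 < t by rewrite divr_gt0.
have t20 : 0 < t ^+ 2 by rewrite exprn_gt0.
have [G GE] : exists G : {linear H -> H}, G = (fun z => P z + (t ^+ 2)%:C *: z) :> (H -> H).
  apply: linear_of_fun => c z w.
  by rewrite [P _]linearP /= [in LHS]scalerDr [in RHS]scalerDr addrACA !scalerA (mulrC c).
(* x need not be in the range of P, but it is in the range of P + t^2. *)
have [z Gz] : exists z, G z = x.
  have [|||||z hz] := @lax_milgram _ _ _ norm_dot G (fun z => ip x z) (t ^+ 2) (rnorm x) _ t20.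
  - by move=> z w; rewrite GE !ipE Psym.
  - by move=> z; rewrite GE !ipE (ipxx norm_dot) lerDr.
  - by move=> z w; rewrite ipDr.
  - by move=> c z; rewrite ipZr.
  - by move=> z; exact: (ip_cauchy_schwarz norm_dot).
  by exists z; apply: (ip_nondeg norm_dot) => w; rewrite ipC hz ipC.
rewrite GE in Gz.
have aE : a = ip (P (P z)) (P z) + 2 * t ^+ 2 * rnorm (P z) ^+ 2 + (t ^+ 2) ^+ 2 * ip (P z) z.
  rewrite /a -Gz linearD [P (_ *: _)]linearZ /= !ipE.
  by rewrite (Psym (P z) z) (ipxx norm_dot); lra.
have q1 : 0 <= (t ^+ 2) ^+ 2 * ip (P z) z by apply: mulr_ge0; [exact: sqr_ge0|exact: P0].
have q2 : 0 <= t ^+ 2 * rnorm (P z) ^+ 2 by apply: mulr_ge0; exact: sqr_ge0.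
have q3 : 0 <= ip (P (P z)) (P z) by exact: P0.
have h1 : ip (A (P z)) y ^+ 2 <= a * b.
  rewrite sqrt_intertwine; apply: le_trans (positive_cauchy_schwarz _ _ Qsym Q0) _.
  apply: ler_wpM2r => //; rewrite -sqrt_intertwine AS -PP -Psym aE; lra.
have h2 : t * rnorm (A z) <= Num.sqrt a.
  rewrite -rnorm_sqrt -[leLHS]ger0_norm; last exact: mulr_ge0 (ltW t0) (rnorm_ge0 _).
  rewrite -sqrtr_sqr ler_sqrt// exprMn aE; lra.
rewrite -Gz linearD [A (_ *: _)]linearZ /= ipDl ipZl [leRHS]addrC.
apply: le_trans (ler_normD _ _) _; apply: lerD.
  by rewrite -sqrtr_sqr ler_sqrt.
rewrite normrM gtr0_norm//.
apply: (@le_trans _ _ (t * (Num.sqrt a * rnorm y))).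
  rewrite expr2 -mulrA ler_pM2l//.
  apply: le_trans (_ : t * (rnorm (A z) * rnorm y) <= _).
    by rewrite ler_pM2l// ip_cauchy_schwarz.
  by rewrite mulrA ler_wpM2r ?rnorm_ge0.
by rewrite /t mulrAC ler_pdivrMr// ler_pM2l//; lra.
Qed.

Lemma mixed_schwarz_diag x : rnorm (dot (A x) x) ^+ 2 <= ip (P x) x * ip (Q x) x.
Proof.
set c := dot (A x) x.
have [->|c0] := eqVneq c 0.
  by rewrite rnorm0 expr0n mulr_ge0 ?positive_op_ge0.
have cp : 0 < rnorm c ^+ 2.
  rewrite exprn_even_gt0//=; apply: contraNneq c0 => /rnorm_eq0 ->; exact: eqxx.
have := mixed_schwarz x (c *: x).
rewrite ip_scale_dot -/c.
have -> : ip (Q (c *: x)) (c *: x) = rnorm c ^+ 2 * ip (Q x) x.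
  rewrite [Q _]linearZ /= /re_dot (linearZl_LR dot) (linearZr_LR dot) /= mulrA.
  by rewrite -sqr_normc rnormE -rmorphXn; case: (dot _ _) => u v /=; rewrite mul0r subr0.
by rewrite mulrCA expr2 ler_pM2l.
Qed.

End MixedSchwarz.

(** * Numerical radius *)

Section NumericalRadius.
Variables (R : realType) (H : normedModType R[i]) (dot : {dot H for (@Num.conj R[i])}).
Hypothesis norm_dot : forall x : H, `|x| ^+ 2 = dot x x.
Local Notation ip := (re_dot dot).

Lemma rnorm_dot_le (x y : H) : rnorm (dot x y) <= rnorm x * rnorm y.
Proof.
have := ip_le norm_dot x (dot x y *: y); rewrite ip_scale_dot rnormZ expr2.
have [->|c0] := eqVneq (rnorm (dot x y)) 0; first by rewrite mulr_ge0 ?rnorm_ge0.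
by rewrite mulrCA ler_pM2l // lt_neqAle eq_sym c0 rnorm_ge0.
Qed.

Lemma numradius_lub (T : H -> H) (M : R) : 0 <= M ->
  (forall x, rnorm x = 1 -> rnorm (dot (T x) x) <= M) -> numradius dot T <= M.
Proof.
move=> M0 TM; rewrite /numradius; set E := [set _ | _ in _].
have [->|/set0P[x Ex]] := eqVneq E classical_sets.set0; first by rewrite sup0.
by apply: ge_sup => [|_ [y /= y1 <-]]; [exists x|exact: TM].
Qed.

Lemma numradius_ub (T : H -> H) (x : H) : bounded_op T -> rnorm x = 1 ->
  rnorm (dot (T x) x) <= numradius dot T.
Proof.
move=> /bounded_op_pos[M M0 TM] x1; apply: sup_upper_bound; last by exists x.
split; first by exists (rnorm (dot (T x) x)), x.
exists M => _ [y /= y1 <-]; apply: le_trans (rnorm_dot_le _ _) _.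
by rewrite y1 mulr1; apply: le_trans (TM _) _; rewrite y1 mulr1.
Qed.

Lemma rnorm_quadratic_le (T : {linear H -> H}) (x : H) : bounded_op T ->
  rnorm (dot (T x) x) <= numradius dot T * rnorm x ^+ 2.
Proof.
move=> bT; have [->|x0] := eqVneq x 0.
  by rewrite (linear0 T) (linear0l dot) !rnorm0 expr0n mulr0.
have xp : 0 < rnorm x.
  by rewrite lt_neqAle rnorm_ge0 andbT eq_sym; apply: contraNneq x0 => /rnorm_eq0 ->.
pose t := (rnorm x)^-1; have t0 : 0 < t by rewrite invr_gt0.
have := @numradius_ub T (t%:C *: x) bT; rewrite rnormZr gtr0_norm// mulVf ?gt_eqF// => /(_ erefl).
rewrite [T _]linearZ /= (linearZl_LR dot) (linearZr_LR dot) /=.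
rewrite (_ : Num.conj t%:C = t%:C); last exact: conjc_real.
rewrite mulrA -rmorphM.
have -> : rnorm ((t * t)%:C * dot (T x) x) = t * t * rnorm (dot (T x) x).
  by rewrite rnormM rnorm_real ger0_norm// mulr_ge0// ltW.
by rewrite -invfM -expr2 mulrC ler_pdivrMr ?exprn_gt0.
Qed.

(** The terms in g are the usual ones with factors i and -i, of which the real
    part has been taken. *)
Lemma polarization (T : {linear H -> H}) (x y : H) :
  let f z := ip (T z) z in let g z := ip (T z) ('i *: z) in
  4 * ip (T x) y =
    f (x + y) - f (x - y) - g (x + 'i *: y) + g (x - 'i *: y).
Proof.
rewrite /= !(linearD T) !(linearN T) [T ('i *: y)]linearZ /= !scalerDr !scalerN scale_i_i !ipE.
by rewrite !ip_ii; lra.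
Qed.

(** In the polarization identity with y = T x / ||T x|| the left side is 4 ||T x||,
    and on the right the quadratic form is evaluated at vectors with squared
    norms summing to 4 (||x||^2 + 1) <= 8. *)
Lemma opnorm_le_numradius (T : {linear H -> H}) : bounded_op T ->
  2^-1 * opnorm T <= numradius dot T.
Proof.
move=> bT; set w := numradius dot T.
have w0 : 0 <= w.
  rewrite /w /numradius; set E := [set _ | _ in _].
  have [->|/set0P[_ [z z1 _]]] := eqVneq E classical_sets.set0; first by rewrite sup0.
  by apply: le_trans (numradius_ub bT z1); exact: rnorm_ge0.
suff : opnorm T <= 2 * w by lra.
apply: opnorm_lub => x x1.
have [->|Tx0] := eqVneq (rnorm (T x)) 0; first by rewrite mulr_ge0.
have Txp : 0 < rnorm (T x) by rewrite lt_neqAle eq_sym Tx0 rnorm_ge0.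
pose y := (rnorm (T x))^-1%:C *: T x.
have y1 : rnorm y = 1 by rewrite rnormZr gtr0_norm ?invr_gt0// mulVf.
have Txy : ip (T x) y = rnorm (T x).
  by rewrite ipZr (ipxx norm_dot) expr2 mulrA mulVf// mul1r.
have f_le z : `|ip (T z) z| <= w * rnorm z ^+ 2.
  apply: le_trans (rnorm_quadratic_le z bT).
  by rewrite -lecR -rnormE; exact: normc_ge_Re.
have g_le z : `|ip (T z) ('i *: z)| <= w * rnorm z ^+ 2.
  apply: le_trans (rnorm_quadratic_le z bT).
  rewrite ip_ir -lecR -rnormE normc_def lecR -sqrtr_sqr ler_sqrt ?addr_ge0 ?sqr_ge0//.
  by rewrite lerDr sqr_ge0.
have parallelogram (a b : H) : rnorm (a + b) ^+ 2 + rnorm (a - b) ^+ 2 =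
    2 * (rnorm a ^+ 2 + rnorm b ^+ 2) :> R.
  by rewrite -!(ipxx norm_dot) !ipE (ipC _ b a); lra.
have := polarization T x y; rewrite /= Txy.
have := f_le (x + y); have := f_le (x - y).
have := g_le (x + 'i *: y); have := g_le (x - 'i *: y).
rewrite !ler_norml => /andP[_ h1] /andP[h2 _] /andP[h3 _] /andP[_ h4] h5.
have iy1 : rnorm ('i *: y) ^+ 2 = 1 by rewrite -(ipxx norm_dot) ip_ii (ipxx norm_dot) y1 expr1n.
have x2 : rnorm x ^+ 2 <= 1 by rewrite exprn_ile1// rnorm_ge0.
have p1 := congr1 ( *%R w) (parallelogram x y).
have p2 := congr1 ( *%R w) (parallelogram x ('i *: y)).
have := ler_wpM2l w0 x2.
rewrite iy1 y1 expr1n !mulrDr in p1 p2 *.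
lra.
Qed.

End NumericalRadius.

(** * Kantorovich constant *)

Section Kantorovich.
Variable R : realType.
Implicit Types a b c r : R.

Lemma kantorovich2E a b : a != 0 -> b != 0 -> kantorovich2 (a / b) = (a + b) ^+ 2 / (4 * (a * b)).
Proof. by move=> a0 b0; rewrite /kantorovich2; field; rewrite a0 b0. Qed.

Lemma kantorovich2_ge1 a b : 0 < a -> 0 < b -> 1 <= kantorovich2 (a / b).
Proof.
move=> a0 b0; rewrite kantorovich2E ?gt_eqF// ler_pdivlMr ?mulr_gt0// mul1r.
have := sqr_ge0 (a - b); rewrite sqrrB sqrrD; lra.
Qed.

Lemma powR_kantorovich2_ge1 a b r : 0 < a -> 0 < b -> 0 <= r -> 1 <= kantorovich2 (a / b) `^ r.
Proof. by move=> a0 b0 r0; rewrite -(powRr0 (kantorovich2 (a / b))) ler_powR ?kantorovich2_ge1. Qed.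

(** K(a / b, 2)^(1/2) is the ratio of the arithmetic to the geometric mean of a
    and b. As K >= 1, an exponent r <= 1/2 only makes the left side smaller. *)
Lemma amgm_kantorovich2 a b c r : 0 < a -> 0 < b -> 0 <= c -> c ^+ 2 <= a * b ->
  r <= 2^-1 -> c * kantorovich2 (a / b) `^ r <= (a + b) / 2.
Proof.
move=> a0 b0 c0 cab r2; have K1 := kantorovich2_ge1 a0 b0.
have K0 := le_trans ler01 K1.
apply: (@le_trans _ _ (c * Num.sqrt (kantorovich2 (a / b)))).
  by rewrite -powR12_sqrt//; apply: ler_wpM2l => //; apply: ler_powR.
rewrite -ler_sqr ?nnegrE ?mulr_ge0 ?sqrtr_ge0//; last by rewrite addr_ge0// ltW.
rewrite exprMn sqr_sqrtr// kantorovich2E ?gt_eqF//.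
have q0 : 0 <= (a + b) ^+ 2 / (4 * (a * b)).
  by rewrite divr_ge0 ?sqr_ge0// !mulr_ge0// ltW.
apply: le_trans (ler_wpM2r q0 cab) _; rewrite le_eqVlt; apply/orP; left; apply/eqP.
by field; rewrite !gt_eqF.
Qed.

End Kantorovich.

(** * Comparison of the bound with the numerical radius and the norm *)

Local Close Scope complex_scope.

Theorem theorem3p5 (R : realType) (H : completeNormedModType R[i])
    (dot : {dot H for (@Num.conj R[i])})
    (norm_dot : forall x : H, `|x| ^+ 2 = dot x x)
    (A : {linear H -> H}) (bounded_A : bounded_op A)
    (hyponormal_A : hyponormal dot A)
    (lambda : R) (lambda_ge0 : 0 <= lambda) (lambda_le1 : lambda <= 1) :
  let r := Num.min lambda (1 - lambda) in
  let bound := (inf_zeta dot A r)^-1 *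
    (opnorm (fun x => abs_op dot A x + abs_op dot (adjoint dot A) x) / 2) in
  [/\ numradius dot A <= bound,
      2^-1 * opnorm A <= numradius dot A &
      bound <= opnorm A].
Proof.
move=> r bound.
have r0 : 0 <= r by rewrite le_min lambda_ge0 subr_ge0.
have r2 : r <= 2^-1 by rewrite ge_min; case: (leP lambda 2^-1) => //= ?; lra.
have [bS AS] := adjoint_spec norm_dot bounded_A.
have [bP pP PP] := abs_op_spec norm_dot bounded_A.
have [bQ pQ QQ] := abs_op_spec norm_dot bS.
set S := adjoint dot A in bS AS pQ bQ PP QQ *.
set P := abs_op dot A in bP pP PP *.
set Q := abs_op dot S in bQ pQ QQ *.
have {}QQ x : Q (Q x) = A (S x) by rewrite QQ adjointK.
have SA x y : re_dot dot (S x) y = re_dot dot x (A y) by rewrite ipC -AS ipC.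
have normP x : rnorm (P x) = rnorm (A x) by exact: rnorm_sqrt AS pP PP x.
have normQ x : rnorm (Q x) = rnorm (S x) by exact: rnorm_sqrt SA pQ QQ x.
have normS x : rnorm (S x) <= rnorm (A x).
  have := positive_op_ge0 x hyponormal_A.
  rewrite /= -/S ipBl SA (AS (S x)) !(ipxx norm_dot) subr_ge0.
  by rewrite ler_sqr ?nnegrE ?rnorm_ge0.
pose T x := P x + Q x.
have T_le x : rnorm (T x) <= 2 * rnorm (A x).
  by apply: le_trans (rnormD _ _) _; rewrite normP normQ; have := normS x; lra.
have bT : bounded_op T.
  have [M hM] := bounded_A; exists (2 * M) => x.
  by apply: le_trans (T_le x) _; rewrite -mulrA ler_pM2l.
have opT : opnorm T <= 2 * opnorm A.
  apply: opnorm_lub => x x1; apply: le_trans (T_le x) _.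
  by rewrite ler_pM2l// opnorm_ub.
have opT0 := opnorm_ge0 bT; have opA0 := opnorm_ge0 bounded_A.
have P0 x := positive_op_ge0 x pP; have Q0 x := positive_op_ge0 x pQ.
have T_ge x : rnorm x = 1 -> qform dot P x + qform dot Q x <= opnorm T.
  move=> x1; apply: le_trans (opnorm_ub bT (_ : rnorm x <= 1)); last by rewrite x1.
  rewrite -[leRHS]mulr1 -x1; apply: le_trans (ip_le norm_dot _ _).
  by rewrite ipDl.
have schwarz x : rnorm (dot (A x) x) ^+ 2 <= qform dot P x * qform dot Q x.
  exact: (mixed_schwarz_diag norm_dot bounded_A AS bP bQ pP pQ PP QQ x).
(* If <|A| x, x> = 0 then A x = 0, hence A^* x = 0 by hyponormality, hence
   <|A^*| x, x> = 0: zeta is only evaluated at positive ratios. *)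
have qP_gt0 x : qform dot Q x != 0 -> 0 < qform dot P x.
  move=> q0; rewrite lt_neqAle P0 andbT eq_sym; apply: contraNneq q0 => p0.
  have := positive_cauchy_schwarz x (P x) (positive_op_symmetric pP) P0.
  rewrite -[re_dot dot (P x) x]/(qform dot P x) p0 mul0r (ipxx norm_dot) -exprM.
  rewrite exprn_even_le0//= normP => /eqP Ax0.
  have Qx0 : Q x = 0.
    apply: rnorm_eq0; apply/eqP; rewrite eq_le rnorm_ge0 andbT normQ.
    by apply: le_trans (normS x) _; rewrite Ax0.
  by rewrite /qform Qx0 (linear0l dot).
have qQ_gt0 x : qform dot Q x != 0 -> 0 < qform dot Q x.
  by move=> q0; rewrite lt_neqAle eq_sym q0 Q0.
have schwarz0 x : qform dot Q x = 0 -> rnorm (dot (A x) x) = 0.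
  move=> q0; apply/eqP; rewrite -sqrf_eq0 eq_le sqr_ge0 andbT.
  by apply: le_trans (schwarz x) _; rewrite q0 mulr0.
rewrite /bound -/T -/Q; set Z := inf_zeta dot A r.
(* The infimum over the empty set, which is 0 and makes the bound 0, has to be
   treated apart. *)
have [[ZE q0]|[Z1 Z_le]] : (Z = 0 /\ forall x, rnorm x = 1 -> qform dot Q x = 0) \/
    (1 <= Z /\ forall x, rnorm x = 1 -> qform dot Q x != 0 -> Z <= zeta dot A r x).
  rewrite /Z /inf_zeta -/S -/Q; set E := [set x | _]; set F := [set _ | _ in _].
  have F1 : lbound F 1.
    by move=> _ [x [_ q0] <-]; apply: powR_kantorovich2_ge1; [exact: qP_gt0|exact: qQ_gt0|].
  have [F0|/set0P Fn0] := eqVneq F classical_sets.set0; [left|right]; split.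
  - by rewrite F0 inf0.
  - move=> x x1; apply/eqP/negPn/negP => q0.
    by have : F (zeta dot A r x) by [exists x]; rewrite F0.
  - exact: lb_le_inf.
  - by move=> x x1 q0; apply: ge_inf; [exists 1|exists x].
- rewrite ZE invr0 mul0r; split=> //; last exact: opnorm_le_numradius.
  by apply: numradius_lub => // x x1; rewrite schwarz0 ?q0.
have Zp : 0 < Z by apply: lt_le_trans Z1.
have bound0 : 0 <= Z^-1 * (opnorm T / 2).
  by rewrite mulr_ge0 ?invr_ge0 ?divr_ge0// ltW.
split; last 1 first.
- rewrite mulrC ler_pdivrMr//; apply: le_trans (_ : opnorm A <= _); first lra.
  by rewrite ler_peMr.
- apply: numradius_lub => // x x1.
  have [q0|q0] := eqVneq (qform dot Q x) 0; first by rewrite schwarz0.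
  rewrite mulrC ler_pdivlMr//.
  apply: le_trans (_ : rnorm (dot (A x) x) * zeta dot A r x <= _).
    by rewrite ler_wpM2l ?rnorm_ge0// Z_le.
  apply: le_trans (amgm_kantorovich2 (qP_gt0 _ q0) (qQ_gt0 _ q0) (rnorm_ge0 _) (schwarz x) r2) _.
  by rewrite ler_pM2r ?invr_gt0// T_ge.
- exact: opnorm_le_numradius.
Qed.
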